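(* Let $P=(X,\leq_P)$ be a finite poset with at least two points and no isolated points, and let $C=(Z,\leq_C)$ be a poset of height one which is the ordinal sum $L(C)\oplus U(C)$ of two antichains (i.e. $x<_C y$ iff $x\in L(C)$ and $y\in U(C)$). Then there exists a surjective order-preserving map from $P$ onto $C$ if and only if there exists a separating homomorphism from $\mathfrak{F}(P)$ to $\mathfrak{C}(C)$. Moreover, if $Z\subseteq E(P)$ and $C$ is the induced subposet of $P$ on $Z$, then $C$ is a retract of $P$ if and only if there exists a $Z$-separating homomorphism from $\mathfrak{F}(P)$ to $\mathfrak{C}(C)$.
   Context: Posets: for $P=(X,\leq_P)$, $L(P)$, $U(P)$ are the minimal and maximal points, $E(P):=L(P)\cup U(P)$; ${\downarrow}_P y:=\{x: x\leq_P y\}$, ${\uparrow}_P y:=\{x:y\leq_P x\}$, $[x,y]_P:={\uparrow}_P x\cap{\downarrow}_P y$; subsets are identified with induced subposets. A retract of $P$ is the image of an idempotent order-preserving map $r:P\to P$. A 4-crown in $P$ is a set $\{a,b,v,w\}$ with $a,b<_P v,w$, $a\parallel b$, $v\parallel w$; its inner is $[a,v]_P\cap[b,w]_P$, and it is improper if the inner is nonempty. 4-crown bundles: $\mathcal{C}_{imp}(P)$ is the set of improper 4-crowns contained in $E(P)$; $\mathcal{M}(P)$ is the union of the inners of all members of $\mathcal{C}_{imp}(P)$; for $m\in\mathcal{M}(P)$, $\Xi(m) := (L(P)\cap{\downarrow}_P m)\cup(U(P)\cap{\uparrow}_P m)$; $\mathcal{F}(P)$ is the set of inclusion-maximal members of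 $\{\Xi(m): m\in\mathcal{M}(P)\}$. $\mathfrak{F}(P)$ is the multigraph with vertex set $\mathcal{F}(P)$ having an L-edge between $F,G$ (loops allowed) iff $L(P)\cap F\cap G\neq\emptyset$ and a U-edge iff $U(P)\cap F\cap G\neq\emptyset$. For $C$ of height one with carrier $Z=L(C)\cup U(C)$: for $a\in L(C)$, $\curlyvee(a):=\{\{a\}\cup N:\emptyset\neq N\subseteq U(C)\}$, $\mathcal{L}:=\bigcup_{a\in L(C)}\curlyvee(a)$; for $v\in U(C)$, $\curlywedge(v):=\{\{v\}\cup N:\emptyset\neq N\subseteq L(C)\}$, $\mathcal{U}:=\bigcup_{v\in U(C)}\curlywedge(v)$. $\mathcal{C}_0(C):=\{S\in\mathcal{L}:\exists a\in L(C),\ S\subseteq{\uparrow}_C a\}\cup\{S\in\mathcal{U}:\exists v\in U(C),\ S\subseteq{\downarrow}_C v\}$. $\mathfrak{C}(C)$ is the multigraph with vertex set $\mathcal{C}_0(C)$ having an L-edge between $S,T$ iff $L(C)\cap S\cap T\neq\emptyset$ and a U-edge iff $U(C)\cap S\cap T\neq\emptyset$. A homomorphism $\phi:\mathfrak{F}(P)\to\mathfrak{C}(C)$ is a map $\mathcal{F}(P)\to\mathcal{C}_0(C)$ such that an L-edge (U-edge) between $F$ and $G$ implies an L-edge (U-edge) between $\phi(F)$ and $\phi(G)$. It is separating if there is an injective $i:Z\to E(P)$ with $i[L(C)]\subseteq L(P)$, $i[U(C)]\subseteq U(P)$ such that for all $a\in L(C)$, $v\in U(C)$, $F\in\mathcal{F}(P)$: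 ($i(a)\in F$ and $\phi(F)\in\mathcal{L}$) implies $\phi(F)\in\curlyvee(a)$, and ($i(v)\in F$ and $\phi(F)\in\mathcal{U}$) implies $\phi(F)\in\curlywedge(v)$; such $i$ is said to belong to $\phi$. $\phi$ is $Z$-separating if $Z\subseteq E(P)$ and the belonging $i$ satisfies $i[Z]=Z$. *)

(* Defs.v *)
From HB Require Import structures.
From mathcomp Require Import all_boot all_order.
From mathcomp Require Import boolp classical_sets functions.

Set Implicit Arguments.
Unset Strict Implicit.
Unset Printing Implicit Defensive.

Import Order.Theory.

Local Open Scope order_scope.
Local Open Scope classical_set_scope.

(* An alias of [set_type Z], so that the induced order is not put on every set. *)
Definition subposet (d : Order.disp_t) (T : porderType d) (Z : set T) : Type :=
  set_type Z.

HB.instance Definition _ (d : Order.disp_t) (T : porderType d) (Z : set T) :=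
  SubChoice.on (subposet Z).
HB.instance Definition _ (d : Order.disp_t) (T : porderType d) (Z : set T) :=
  [SubChoice_isSubPOrder of subposet Z by <: with d].

Section Posets.
Context (d : Order.disp_t) (T : porderType d).
Implicit Types (x y a b v w m : T) (S N F : set T).

Definition minpts : set T := [set x | forall y, y <= x -> y = x].
Definition maxpts : set T := [set x | forall y, x <= y -> y = x].
Definition extpts : set T := minpts `|` maxpts.

Definition downset y : set T := [set x | x <= y].
Definition upset y : set T := [set x | y <= x].
Definition segment x y : set T := upset x `&` downset y.

Definition isolated x : Prop := forall y, y >=< x -> y = x.

Definition retract (Z : set T) : Prop :=
  exists r : T -> T,
    [/\ {homo r : x y / x <= y}, forall x, r (r x) = r x & range r = Z].

Definition height_one : Prop :=
  (exists x y, x < y) /\ ~ (exists x y z, x < y /\ y < z).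

Definition ordinal_sum_of_extrema : Prop :=
  forall x y, x < y <-> minpts x /\ maxpts y.

(* A 4-crown {a, b, v, w} is handled through its labellings (a, b, v, w); the
   inner does not depend on the labelling, because
   [a, v] `&` [b, w] = [a, w] `&` [b, v]. *)
Definition crown4 a b v w : Prop :=
  [/\ a < v /\ a < w, b < v /\ b < w, a >< b & v >< w].

Definition inner a b v w : set T := segment a v `&` segment b w.

Definition improper_ext_crowns : set (T * T * T * T) :=
  [set c | let: (a, b, v, w) := c in
     [/\ crown4 a b v w, [set a; b; v; w] `<=` extpts & inner a b v w !=set0]].

Definition inner_pts : set T :=
  \bigcup_(c in improper_ext_crowns) let: (a, b, v, w) := c in inner a b v w.

Definition Xi m : set T :=
  (minpts `&` downset m) `|` (maxpts `&` upset m).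

Definition maximal_bundles : set (set T) :=
  [set F | (Xi @` inner_pts) F /\
     forall G, (Xi @` inner_pts) G -> F `<=` G -> G = F].

Definition curlyvee a : set (set T) :=
  [set S | exists N, [/\ N !=set0, N `<=` maxpts & S = a |` N]].
Definition curlywedge v : set (set T) :=
  [set S | exists N, [/\ N !=set0, N `<=` minpts & S = v |` N]].

Definition lower_stars : set (set T) := \bigcup_(a in minpts) curlyvee a.
Definition upper_stars : set (set T) := \bigcup_(v in maxpts) curlywedge v.

Definition bounded_stars : set (set T) :=
  [set S | lower_stars S /\ exists2 a, minpts a & S `<=` upset a] `|`
  [set S | upper_stars S /\ exists2 v, maxpts v & S `<=` downset v].

End Posets.

Arguments minpts {d} T.
Arguments maxpts {d} T.
Arguments extpts {d} T.
Arguments height_one {d} T.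
Arguments ordinal_sum_of_extrema {d} T.
Arguments inner_pts {d} T.
Arguments maximal_bundles {d} T.
Arguments lower_stars {d} T.
Arguments upper_stars {d} T.
Arguments bounded_stars {d} T.

(* Between two vertices there is at most one L-edge and at most one U-edge, and
   loops are allowed, so the multigraphs needed here are vertex sets with two
   edge relations. *)
Record lu_multigraph (V : Type) := LUMultigraph {
  vertices : set V;
  L_edge : V -> V -> Prop;
  U_edge : V -> V -> Prop
}.

Definition meeting_graph (d : Order.disp_t) (T : porderType d)
    (V : set (set T)) : lu_multigraph (set T) :=
  {| vertices := V;
     L_edge := fun S S' => minpts T `&` S `&` S' !=set0;
     U_edge := fun S S' => maxpts T `&` S `&` S' !=set0 |}.

Definition bundle_graph (d : Order.disp_t) (P : porderType d) :=
  meeting_graph (maximal_bundles P).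
Definition star_graph (d : Order.disp_t) (C : porderType d) :=
  meeting_graph (bounded_stars C).

(* Values of [phi] outside the vertex set of [A] are irrelevant. *)
Definition homomorphism (V W : Type) (A : lu_multigraph V) (B : lu_multigraph W)
    (phi : V -> W) : Prop :=
  [/\ set_fun (vertices A) (vertices B) phi,
      forall F G, vertices A F -> vertices A G ->
        L_edge A F G -> L_edge B (phi F) (phi G) &
      forall F G, vertices A F -> vertices A G ->
        U_edge A F G -> U_edge B (phi F) (phi G)].

Section Separating.
Context (dP dC : Order.disp_t) (P : porderType dP) (C : porderType dC).

Definition belongs (i : C -> P) (phi : set P -> set C) : Prop :=
  [/\ injective i,
      set_fun (minpts C) (minpts P) i,
      set_fun (maxpts C) (maxpts P) i &
      forall a v F, minpts C a -> maxpts C v -> maximal_bundles P F ->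
        (F (i a) -> lower_stars C (phi F) -> curlyvee a (phi F)) /\
        (F (i v) -> upper_stars C (phi F) -> curlywedge v (phi F))].

Definition separating_hom (phi : set P -> set C) : Prop :=
  homomorphism (bundle_graph P) (star_graph C) phi /\
  exists i, belongs i phi.

End Separating.

(* Here C is the induced subposet on Z, so i[Z] is the range of [i]. *)
Definition Z_separating_hom (d : Order.disp_t) (P : porderType d) (Z : set P)
    (phi : set P -> set (subposet Z)) : Prop :=
  [/\ homomorphism (bundle_graph P) (star_graph (subposet Z)) phi,
      Z `<=` extpts P &
      exists i : subposet Z -> P, belongs i phi /\ range i = Z].

(* Main.v *)
Require Import Defs.
From HB Require Import structures.
From mathcomp Require Import all_boot all_order.
From mathcomp Require Import boolp classical_sets functions.

(** A surjective order-preserving map onto C can be normalised to send minimal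
    points to minimal points and maximal points to maximal points; the images
    of the bundles are then stars, which gives the homomorphism.  Conversely, a
    separating homomorphism labels the minimal points of P by L(C) (by the
    centers of the lower stars) and the maximal points by U(C).  A point above
    two differently labelled minimal points and below two differently labelled
    maximal ones would lie in the inner of an improper crown, hence in a bundle,
    and the image star of that bundle forbids one of the two.  So each point can
    be sent to the unique label below it or to the unique label above it.  In
    both directions the injection i is a section of the order-preserving map. *)

Set Implicit Arguments.
Unset Strict Implicit.

Import Order.Theory.

Local Open Scope order_scope.
Local Open Scope classical_set_scope.

(** * Extremal points and bundles of a finite poset *)

Lemma ex_minpt (d : Order.disp_t) (P : finPOrderType d) (x : P) :
  exists2 y, minpts P y & y <= x.
Proof.
case: (@arg_minnP _ x (fun y => y <= x) (fun y => #|[pred z | z <= y]|)) => //.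
move=> y yx ymin; exists y => // z zy; apply/eqP; rewrite eq_le zy /=.
have sub : [pred t | t <= z] \subset [pred t | t <= y].
  by apply/fintype.subsetP => t; rewrite !inE => /le_trans; apply.
have : [pred t | t <= y] \subset [pred t | t <= z].
  by rewrite -(geq_leqif (subset_leqif_card sub)); exact: ymin (le_trans zy yx).
move=> /fintype.subsetP/(_ y).
by rewrite !inE; apply.
Qed.

Section Extrema.
Context {d : Order.disp_t} {P : finPOrderType d}.
Implicit Types x y m : P.

Lemma ex_maxpt x : exists2 y, maxpts P y & x <= y.
Proof. exact: (@ex_minpt _ P^d x). Qed.

Lemma minpts_maxpts_isolated x : minpts P x -> maxpts P x -> isolated x.
Proof. by move=> xmin xmax y /orP[/xmin|/xmax]. Qed.

(** By finiteness, among the sets [Xi m'] containing [Xi m] one of largest cardinality exists, and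
    it is inclusion-maximal. *)
Lemma sub_maximal_bundle m :
  inner_pts P m -> exists2 F, maximal_bundles P F & Xi m `<=` F.
Proof.
move=> mI.
pose Q m' := `[< inner_pts P m' /\ Xi m `<=` Xi m' >].
have Qm : Q m by apply/asboolP; split.
case: (arg_maxnP (fun m' => #|[pred z | `[< Xi m' z >]]|) Qm).
move=> n /asboolP[nI mn] nmax; exists (Xi n) => //; split; first by exists n.
move=> _ [k kI <-] nk; apply/seteqP; split => // z kz.
have sub : [pred t | `[< Xi n t >]] \subset [pred t | `[< Xi k t >]].
  by apply/fintype.subsetP => t; rewrite !inE; exact: nk.
have : [pred t | `[< Xi k t >]] \subset [pred t | `[< Xi n t >]].
  rewrite -(geq_leqif (subset_leqif_card sub)); apply: nmax; apply/asboolP.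
  by split=> // t /mn/nk.
move=> /fintype.subsetP/(_ z).
by rewrite !inE; apply.
Qed.

Hypothesis noiso : forall x, ~ isolated x.

Lemma minpts_not_maxpts x : minpts P x -> ~ maxpts P x.
Proof. by move=> xmin /(minpts_maxpts_isolated xmin); exact: noiso. Qed.

Lemma inner_pts_extrema a b v w m :
  minpts P a -> minpts P b -> maxpts P v -> maxpts P w -> a <> b -> v <> w ->
  a <= m -> b <= m -> m <= v -> m <= w -> inner_pts P m.
Proof.
move=> amin bmin vmax wmax ab vw am bm mv mw.
(* Strictness comes from the absence of isolated points: [x = y] would be both minimal and
   maximal. *)
have ltmM x y : minpts P x -> maxpts P y -> x <= m -> m <= y -> x < y.
  move=> xmin ymax xm my; rewrite lt_neqAle (le_trans xm my) andbT.
  by apply/eqP => xy; apply: (minpts_not_maxpts xmin); rewrite xy.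
exists (a, b, v, w) => //; split.
- split.
  + by split; exact: ltmM.
  + by split; exact: ltmM.
  + by apply/negP => /orP[/bmin|/amin/esym].
  + by apply/negP => /orP[/vmax/esym|/wmax].
- by move=> x [[[->|->]|->]|->]; by [left | right].
- by exists m.
Qed.

End Extrema.

(** * Stars in an ordinal sum of two antichains *)

Section Stars.
Context {d : Order.disp_t} {C : porderType d}.
Hypotheses (hC : height_one C) (oC : ordinal_sum_of_extrema C).
Implicit Types (a v c z : C) (S : set C).

Lemma ordinal_sum_ex : (exists a, minpts C a) /\ (exists v, maxpts C v).
Proof. by case: hC => -[x [y /oC[? ?]]] _; split; [exists x | exists y]. Qed.

Lemma ordinal_sum_disjoint c : minpts C c -> ~ maxpts C c.
Proof. by move=> cmin cmax; have := (oC c c).2 (conj cmin cmax); rewrite ltxx. Qed.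

Lemma ordinal_sum_cover c : minpts C c \/ maxpts C c.
Proof.
case: (pselect (minpts C c)) => [|/existsNP[y /not_implyP[yc /eqP ne]]].
  by left.
by right; have /oC[] : y < c by rewrite lt_neqAle ne.
Qed.

Lemma ordinal_sum_le a v : minpts C a -> maxpts C v -> a <= v.
Proof. by move=> amin vmax; apply/ltW/oC. Qed.

(** The rest of a lower star lies in U(C), which is disjoint from L(C). Hence the star determines
    its center, which can serve as a label. *)
Lemma curlyvee_center a S z : curlyvee a S -> minpts C z -> S z -> z = a.
Proof.
by move=> [N [_ NU ->]] zmin [//|/NU /(ordinal_sum_disjoint zmin)].
Qed.

Lemma curlywedge_center v S z : curlywedge v S -> maxpts C z -> S z -> z = v.
Proof.
by move=> [N [_ NL ->]] zmax [//|/NL/ordinal_sum_disjoint].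
Qed.

(** The center itself is the bound, since it lies below all of U(C). *)
Lemma lower_star_bounded a S : minpts C a -> curlyvee a S -> bounded_stars C S.
Proof.
move=> amin aS; left; split; first by exists a.
exists a => //; case: aS => N [_ NU ->] z [->|/NU zmax]; first exact: lexx.
exact: ordinal_sum_le.
Qed.

Lemma upper_star_bounded v S : maxpts C v -> curlywedge v S -> bounded_stars C S.
Proof.
move=> vmax vS; right; split; first by exists v.
exists v => //; case: vS => N [_ NL ->] z [->|/NL zmin]; first exact: lexx.
exact: ordinal_sum_le.
Qed.

End Stars.

(** Used to extend labels forced on some points of [P] to all of them; points without a forced label
    get the default [c0]. *)
Lemma ex_labelling (T T' : Type) (A : set T') (R : T -> T' -> Prop) :
  A !=set0 -> (forall x c, R x c -> A c) ->
  (forall x c c', R x c -> R x c' -> c = c') ->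
  exists g : T -> T', (forall x, A (g x)) /\ (forall x c, R x c -> g x = c).
Proof.
move=> [c0 Ac0] RA Runiq.
have ex x : exists c, A c /\ forall c', R x c' -> c = c'.
  case: (pselect (exists c, R x c)) => [[c xc]|none].
    by exists c; split=> [|c' /(Runiq _ _ _ xc)//]; exact: RA xc.
  by exists c0; split=> // c' xc'; case: none; exists c'.
have [g gP] := choice ex.
by exists g; split=> [x | x c]; [exact: (gP x).1 | exact: (gP x).2].
Qed.

(** * From maps with section [i] to separating homomorphisms and back *)

Section Correspondence.
Context {d dC : Order.disp_t} {P : finPOrderType d} {C : porderType dC}.
Hypothesis noiso : forall x : P, ~ isolated x.
Hypotheses (hC : height_one C) (oC : ordinal_sum_of_extrema C).
Variable i : C -> P.

(* A minimal point of [P] sent into U(C) has only images in U(C) above it, so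
   its own image may be replaced by any point of L(C); dually for maximal points. *)
Lemma normalise_section (f : P -> C) :
  set_fun (minpts C) (minpts P) i -> set_fun (maxpts C) (maxpts P) i ->
  {homo f : x y / x <= y} -> cancel i f ->
  exists g : P -> C,
    [/\ {homo g : x y / x <= y}, cancel i g,
        set_fun (minpts P) (minpts C) g & set_fun (maxpts P) (maxpts C) g].
Proof.
move=> iL iU fmono fi; have [[a0 a0min] [v0 v0max]] := ordinal_sum_ex hC oC.
pose g x := if `[< minpts P x /\ maxpts C (f x) >] then a0 else
            if `[< maxpts P x /\ minpts C (f x) >] then v0 else f x.
have disj := ordinal_sum_disjoint oC.
have disjP := minpts_not_maxpts noiso.
(* Off the maximal points [g] can only lower [f], off the minimal points only raise it. For [x < y]
   this gives [g x <= f x <= f y <= g y]. *)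
have g_le x : ~ maxpts P x -> g x <= f x.
  move=> xmax; rewrite /g; case: asboolP => [[_ fx]|_].
    exact: ordinal_sum_le.
  by case: asboolP => [[]|].
have g_ge x : ~ minpts P x -> f x <= g x.
  move=> xmin; rewrite /g; case: asboolP => [[]//|_].
  by case: asboolP => [[_ fx]|//]; exact: ordinal_sum_le.
exists g; split.
- move=> x y; case: (eqVneq x y) => [-> //|xy le_xy].
  have nx : ~ maxpts P x by move=> /(_ _ le_xy) yx; rewrite yx eqxx in xy.
  have ny : ~ minpts P y by move=> /(_ _ le_xy) yx; rewrite yx eqxx in xy.
  exact: le_trans (g_le _ nx) (le_trans (fmono _ _ le_xy) (g_ge _ ny)).
- move=> c; rewrite /g fi; case: asboolP => [[icmin cmax]|_].
    by case: (disjP _ icmin); exact: iU.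
  case: asboolP => // -[icmax cmin].
  by case: (disjP _ (iL _ cmin) icmax).
- move=> x xmin; rewrite /g; case: asboolP => // nx.
  case: asboolP => [[/(disjP _ xmin)]//|_].
  by case: (ordinal_sum_cover oC (f x)) => // fx; case: nx.
- move=> x xmax; rewrite /g; case: asboolP => [[/disjP]//|_].
  case: asboolP => // nx.
  by case: (ordinal_sum_cover oC (f x)) => // fx; case: nx.
Qed.

(** The center is [g m]: if it is minimal, every minimal point below [m] is mapped to it, and the
    maximal points above [m] supply the rest of the star. The other case is dual. *)
Lemma image_bundle_star (g : P -> C) (m : P) :
  {homo g : x y / x <= y} ->
  set_fun (minpts P) (minpts C) g -> set_fun (maxpts P) (maxpts C) g ->
  bounded_stars C (g @` Xi m).
Proof.
move=> gmono gL gU; case: (ordinal_sum_cover oC (g m)) => gm.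
- apply: (lower_star_bounded oC gm); exists (g @` (maxpts P `&` upset m)); split.
  + by have [v vmax mv] := ex_maxpt m; exists (g v); exists v.
  + by move=> _ [x [xmax _] <-]; exact: gU.
  + apply/seteqP; split => [_ [x [[xmin xm]|[xmax mx]] <-]|c [->|[x xP <-]]].
    * by left; exact/gm/gmono.
    * by right; exists x.
    * have [y ymin ym] := ex_minpt m; exists y; first by left.
      exact/gm/gmono.
    * by exists x => //; right.
- apply: (upper_star_bounded oC gm); exists (g @` (minpts P `&` downset m)); split.
  + by have [v vmin mv] := ex_minpt m; exists (g v); exists v.
  + by move=> _ [x [xmin _] <-]; exact: gL.
  + apply/seteqP; split => [_ [x [[xmin xm]|[xmax mx]] <-]|c [->|[x xP <-]]].
    * by right; exists x.
    * by left; exact/gm/gmono.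
    * have [y ymax my] := ex_maxpt m; exists y; first by right.
      exact/gm/gmono.
    * by exists x => //; left.
Qed.

Lemma section_separating (f : P -> C) :
  set_fun (minpts C) (minpts P) i -> set_fun (maxpts C) (maxpts P) i ->
  {homo f : x y / x <= y} -> cancel i f ->
  exists phi : set P -> set C,
    homomorphism (bundle_graph P) (star_graph C) phi /\ belongs i phi.
Proof.
move=> iL iU fmono fi.
have [g [gmono gi gL gU]] := normalise_section iL iU fmono fi.
(* Direct images carry common extremal points of two bundles to common extremal points of the two
   stars. *)
exists (fun F => g @` F); split; split.
- by move=> _ [[m _ <-] _]; exact: image_bundle_star.
- move=> F G _ _ [x [[xmin Fx] Gx]]; exists (g x).
  by split; [split; [exact: gL | exists x] | exists x].
- move=> F G _ _ [x [[xmax Fx] Gx]]; exists (g x).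
  by split; [split; [exact: gU | exists x] | exists x].
- exact: can_inj gi.
- exact: iL.
- exact: iU.
- move=> a v F amin vmax _; split=> [Fia [c cmin cF]|Fiv [c cmax cF]].
  + suff -> : a = c by [].
    by apply: (curlyvee_center oC cF amin); exists (i a).
  + suff -> : v = c by [].
    by apply: (curlywedge_center oC cF vmax); exists (i v).
Qed.

Section FromHomomorphism.
Variable phi : set P -> set C.
Hypotheses (phi_hom : homomorphism (bundle_graph P) (star_graph C) phi)
  (phi_i : belongs i phi).

Lemma lower_labelling : exists g : P -> C,
  [/\ forall x, minpts C (g x), forall a, minpts C a -> g (i a) = a &
      forall F a x, maximal_bundles P F -> minpts C a -> curlyvee a (phi F) ->
        minpts P x -> F x -> g x = a].
Proof.
case: phi_hom phi_i => _ phiL _ [iinj iL iU isep].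
have [exL [v0 v0max]] := ordinal_sum_ex hC oC.
have sep a F : minpts C a -> maximal_bundles P F -> F (i a) ->
    forall c, minpts C c -> curlyvee c (phi F) -> c = a.
  move=> amin FP Fia c cmin cF.
  have aF : curlyvee a (phi F).
    by apply: (isep a v0 F amin v0max FP).1 => //; exists c.
  by apply: (curlyvee_center oC aF cmin); case: cF => N [_ _ ->]; left.
(* A label is forced by [i] or by the center of a lower star. Injectivity of [i], separation ([sep])
   and L-edges between bundles sharing [x] exclude the three kinds of conflict. *)
pose R x c := minpts C c /\ (x = i c \/
  exists F, [/\ maximal_bundles P F, curlyvee c (phi F), minpts P x & F x]).
have [| x c [] //| x c c' [cmin xc] [c'min xc'] | g [gL gR]] :=
  @ex_labelling _ _ (minpts C) R.
- by [].
- case: xc xc' => [->|[F [FP cF xmin Fx]]].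
    case=> [/iinj//|[F [FP c'F _ Fc]]].
    by rewrite (sep _ _ cmin FP Fc _ c'min c'F).
  case=> [xE|[G [GP c'G _ Gx]]].
    by rewrite xE in Fx; exact: sep c'min FP Fx _ cmin cF.
  have [|z [[zmin Fz] Gz]] := phiL F G FP GP; first by exists x.
  by rewrite -(curlyvee_center oC cF zmin Fz) -(curlyvee_center oC c'G zmin Gz).
exists g; split => // [a amin|F a x FP amin aF xmin Fx]; apply: gR; split=> //.
  by left.
by right; exists F.
Qed.

(** Dual to [lower_labelling], with U-edges in place of L-edges. *)
Lemma upper_labelling : exists g : P -> C,
  [/\ forall x, maxpts C (g x), forall v, maxpts C v -> g (i v) = v &
      forall F v x, maximal_bundles P F -> maxpts C v -> curlywedge v (phi F) ->
        maxpts P x -> F x -> g x = v].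
Proof.
case: phi_hom phi_i => _ _ phiU [iinj iL iU isep].
have [[a0 a0min] exU] := ordinal_sum_ex hC oC.
have sep v F : maxpts C v -> maximal_bundles P F -> F (i v) ->
    forall c, maxpts C c -> curlywedge c (phi F) -> c = v.
  move=> vmax FP Fiv c cmax cF.
  have vF : curlywedge v (phi F).
    by apply: (isep a0 v F a0min vmax FP).2 => //; exists c.
  by apply: (curlywedge_center oC vF cmax); case: cF => N [_ _ ->]; left.
pose R x c := maxpts C c /\ (x = i c \/
  exists F, [/\ maximal_bundles P F, curlywedge c (phi F), maxpts P x & F x]).
have [| x c [] //| x c c' [cmax xc] [c'max xc'] | g [gU gR]] :=
  @ex_labelling _ _ (maxpts C) R.
- by [].
- case: xc xc' => [->|[F [FP cF xmax Fx]]].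
    case=> [/iinj//|[F [FP c'F _ Fc]]].
    by rewrite (sep _ _ cmax FP Fc _ c'max c'F).
  case=> [xE|[G [GP c'G _ Gx]]].
    by rewrite xE in Fx; exact: sep c'max FP Fx _ cmax cF.
  have [|z [[zmax Fz] Gz]] := phiU F G FP GP; first by exists x.
  by rewrite -(curlywedge_center oC cF zmax Fz) -(curlywedge_center oC c'G zmax Gz).
exists g; split => // [v vmax|F v x FP vmax vF xmax Fx]; apply: gR; split=> //.
  by left.
by right; exists F.
Qed.

Lemma separating_section :
  exists2 f : P -> C, {homo f : x y / x <= y} & cancel i f.
Proof.
have [gL [gLmin gLi gLF]] := lower_labelling.
have [gU [gUmax gUi gUF]] := upper_labelling.
have [lo loP] := choice (fun x : P => (exists2P _ _).1 (ex_minpt x)).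
have [hi hiP] := choice (fun x : P => (exists2P _ _).1 (ex_maxpt x)).
pose flat x := forall a b,
  minpts P a -> minpts P b -> a <= x -> b <= x -> gL a = gL b.
have coflat x : ~ flat x -> forall v w,
    maxpts P v -> maxpts P w -> x <= v -> x <= w -> gU v = gU w.
  move=> nflat v w vmax wmax xv xw; apply: contrapT => vw; apply: nflat.
  move=> a b amin bmin ax bx; apply: contrapT => ab.
  have xI : inner_pts P x.
    apply: (inner_pts_extrema noiso amin bmin vmax wmax) => //.
      by move=> abE; apply: ab; rewrite abE.
    by move=> vwE; apply: vw; rewrite vwE.
  have [F FP xF] := sub_maximal_bundle xI.
  (* A lower star labels all minimal points of [F] by its center, against [ab]; an upper star does
     the same for maximal points, against [vw]. *)
  case: phi_hom => /(_ _ FP) [[[c cmin cF] _]|[[c cmax cF] _]] _ _.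
    apply: ab; rewrite (gLF F c a) ?(gLF F c b) //; apply: xF; by left.
  by apply: vw; rewrite (gUF F c v) ?(gUF F c w) //; apply: xF; right.
(* Maximal points are kept out of the first branch so that [f (i v) = v] even if [i v] is flat. *)
pose f x := if `[< ~ maxpts P x /\ flat x >] then gL (lo x) else gU (hi x).
exists f => [x y|c].
- case: (eqVneq x y) => [-> //|xy le_xy].
  have nx : ~ maxpts P x by move=> /(_ _ le_xy) yx; rewrite yx eqxx in xy.
  have [[lox lo_x] [loy lo_y]] := (loP x, loP y).
  have [[hix hi_x] [hiy hi_y]] := (hiP x, hiP y).
  (* Flatness passes down from [y] to [x], so a value of [y] in L(C) is shared by [x]. If both
     values are in U(C), then [x] is not flat and [coflat] equates them. *)
  rewrite /f; case: (asboolP (_ /\ flat y)) => [[ny fy]|_].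
    have fx : flat x.
      by move=> a b amin bmin ax bx; apply: fy => //; exact: le_trans le_xy.
    case: asboolP => [_|[]//].
    by rewrite (fy (lo x) (lo y)) // (le_trans lo_x).
  case: asboolP => [_|nfx]; first exact: ordinal_sum_le.
  rewrite (@coflat x _ (hi x) (hi y)) // => [fx|]; first by apply: nfx.
  exact: le_trans hi_y.
- rewrite /f; case: phi_i => _ iL iU _.
  case: (ordinal_sum_cover oC c) => [cmin|cmax].
    have below x : x <= i c -> x = i c by exact: (iL c cmin).
    case: asboolP => [_|[]].
      by rewrite (below _ (loP (i c)).2) gLi.
    split; first exact/(minpts_not_maxpts noiso)/iL.
    by move=> a b _ _ /below-> /below->.
  case: asboolP => [[]|_]; first by case; exact: iU.
  by rewrite (iU c cmax _ (hiP (i c)).2) gUi.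
Qed.

End FromHomomorphism.
End Correspondence.

(** * Sections of surjections, and induced subposets *)

(** A preimage of a minimal [c] can be moved down to a minimal point of [P]: its image stays below
    [c], hence equals [c]. Dually for maximal [c]. *)
Lemma surjection_section (d dC : Order.disp_t) (P : finPOrderType d)
    (C : porderType dC) (f : P -> C) :
  height_one C -> ordinal_sum_of_extrema C ->
  {homo f : x y / x <= y} -> range f = [set: C] ->
  exists i : C -> P, [/\ cancel i f, set_fun (minpts C) (minpts P) i &
    set_fun (maxpts C) (maxpts P) i].
Proof.
move=> hC oC fmono fsurj.
have ex c : exists x, [/\ f x = c, minpts C c -> minpts P x &
    maxpts C c -> maxpts P x].
  have [x _ fx] : range f c by rewrite fsurj.
  case: (ordinal_sum_cover oC c) => [cmin|cmax].
    have [y ymin yx] := ex_minpt x; exists y; split=> //.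
      by apply: cmin; rewrite -fx; exact: fmono.
    by move/(ordinal_sum_disjoint oC cmin).
  have [y ymax xy] := ex_maxpt x; exists y; split=> //.
    by apply: cmax; rewrite -fx; exact: fmono.
  by move/(ordinal_sum_disjoint oC)/(_ cmax).
have [i iP] := choice ex.
by exists i; split=> c; case: (iP c).
Qed.

Section Subposet.
Context {d : Order.disp_t} {P : finPOrderType d} {Z : set P}.
Hypotheses (ZE : Z `<=` extpts P) (oZ : ordinal_sum_of_extrema (subposet Z))
  (hZ : height_one (subposet Z)).

(** Such a point lies strictly below some point of [Z], so it is not maximal in [P]; as a member of
    [extpts P] it is minimal. *)
Lemma val_minpts : set_fun (minpts (subposet Z)) (minpts P) val.
Proof.
move=> a amin; have [_ [v vmax]] := ordinal_sum_ex hZ oZ.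
have : a < v by exact/oZ.
rewrite ltEsub => av; case: (ZE (set_mem (valP a))) => // amax.
by have := amax _ (ltW av) => va; rewrite va ltxx in av.
Qed.

Lemma val_maxpts : set_fun (maxpts (subposet Z)) (maxpts P) val.
Proof.
move=> v vmax; have [[a amin] _] := ordinal_sum_ex hZ oZ.
have : a < v by exact/oZ.
rewrite ltEsub => av; case: (ZE (set_mem (valP v))) => // vmin.
by have := vmin _ (ltW av) => va; rewrite va ltxx in av.
Qed.

Lemma minpts_val (z : subposet Z) : minpts P (val z) -> minpts (subposet Z) z.
Proof. by move=> zmin y yz; apply/val_inj/zmin; rewrite -leEsub. Qed.

Lemma maxpts_val (z : subposet Z) : maxpts P (val z) -> maxpts (subposet Z) z.
Proof. by move=> zmax y zy; apply/val_inj/zmax; rewrite -leEsub. Qed.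

(** Makes [i \o f] order-preserving. The values of [i] stay in [Z] and keep their level, and the
    ordinal sum compares any two points of different levels. *)
Lemma section_homo (i : subposet Z -> P) :
  set_fun (minpts (subposet Z)) (minpts P) i ->
  set_fun (maxpts (subposet Z)) (maxpts P) i ->
  range i = Z -> {homo i : x y / x <= y}.
Proof.
move=> iL iU iZ x y; rewrite le_eqVlt => /orP[/eqP-> //|/oZ[xmin ymax]].
have ex c : exists z : subposet Z, val z = i c.
  have Zc : Z (i c) by rewrite -iZ; exists c.
  by exists (exist _ (i c) (mem_set Zc)).
have [[x' x'E] [y' y'E]] := (ex x, ex y).
rewrite -x'E -y'E -leEsub; apply: (ordinal_sum_le oZ).
  by apply: minpts_val; rewrite x'E; exact: iL.
by apply: maxpts_val; rewrite y'E; exact: iU.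
Qed.

End Subposet.

Theorem theorem1 (d : Order.disp_t) (P : finPOrderType d)
    (P_ge2 : (2 <= #|P|)%N) (P_noiso : forall x : P, ~ isolated x) :
  (forall (dC : Order.disp_t) (C : porderType dC),
     height_one C -> ordinal_sum_of_extrema C ->
     (exists f : P -> C, {homo f : x y / x <= y} /\ range f = [set: C]) <->
     (exists phi : set P -> set C, separating_hom phi)) /\
  (forall Z : set P,
     Z `<=` extpts P ->
     height_one (subposet Z) -> ordinal_sum_of_extrema (subposet Z) ->
     retract Z <->
     (exists phi : set P -> set (subposet Z), Z_separating_hom phi)).
Proof.
split=> [dC C hC oC|Z ZE hZ oZ]; split.
- move=> [f [fmono fsurj]].
  have [i [fi iL iU]] := surjection_section hC oC fmono fsurj.
  have [phi [phi_hom phi_i]] := section_separating P_noiso hC oC iL iU fmono fi.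
  by exists phi; split=> //; exists i.
- move=> [phi [phi_hom [i phi_i]]].
  have [f fmono fi] := separating_section P_noiso hC oC phi_hom phi_i.
  by exists f; split=> //; apply/seteqP; split=> // c _; exists (i c).
- move=> [r [rmono rr rZ]].
  have Zr x : Z (r x) by rewrite -rZ; exists x.
  (* The corestriction of [r] to [Z]; idempotence makes the inclusion [val] its section. *)
  pose f x : subposet Z := exist _ (r x) (mem_set (Zr x)).
  have fmono : {homo f : x y / x <= y}.
    by move=> x y /rmono; rewrite leEsub.
  have fi : cancel val f.
    move=> z; apply: val_inj => /=.
    have [x _ <-] : range r (val z) by rewrite rZ; exact/set_mem/valP.
    exact: rr.
  have [phi [phi_hom phi_i]] := section_separating P_noiso hZ oZ
    (val_minpts ZE oZ hZ) (val_maxpts ZE oZ hZ) fmono fi.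
  exists phi; split=> //; exists val; split=> //.
  apply/seteqP; split=> [_ [z _ <-]|x Zx]; first exact/set_mem/valP.
  by exists (exist _ x (mem_set Zx)).
- move=> [phi [phi_hom _ [i [phi_i iZ]]]].
  have [f fmono fi] := separating_section P_noiso hZ oZ phi_hom phi_i.
  have imono : {homo i : x y / x <= y} by case: phi_i => *; exact: section_homo.
  (* [i] may permute [Z], so the retraction is [i \o f]; it is idempotent because [f] inverts
     [i]. *)
  exists (i \o f); split=> [x y /fmono/imono//|x /=|]; first by rewrite fi.
  have iZP y : range i y <-> Z y by rewrite iZ.
  apply/seteqP; split=> [_ [x _ <-]|x]; first by apply/iZP; exists (f x).
  by move=> /iZP[z _ <-]; exists (i z) => //=; rewrite fi.
Qed.
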